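(* Let $(P\colon\mathcal{E}\to\mathcal{B},J,\mathit{Triv})$ be an abelian fibred site with trivial objects and let $\mathit{Loc}\subset P$ be its exact subfibration of locally trivial objects. Suppose that $J_l$-coverings are faithfully flat in $\mathit{Loc}$ and that morphisms of trivial objects (i.e. morphisms of $\mathit{Triv}_b$) are flat in $\mathit{Triv}$. Then morphisms of locally trivial objects (i.e. morphisms of $\mathit{Loc}_b$) are flat in $\mathit{Loc}$.
   Context: Subfunctors. For a functor $P\colon\mathcal{E}\to\mathcal{B}$, a subfunctor $Q\subset P$ consists of subcategories $Q_t\subset\mathcal{E}$ and $Q_b\subset\mathcal{B}$ such that $P$ restricts to $Q\colon Q_t\to Q_b$. Fibres are $\mathcal{E}_B=P^{-1}(B)$. $Q$ is globally full if $Q_t\subset\mathcal{E}$, $Q_b\subset\mathcal{B}$ are full; it is replete if each fibre $Q_B$ is closed in $\mathcal{E}_B$ under isomorphisms. If $P$ is a fibration, a subfibration of $P$ is a subfunctor that is a fibration and whose inclusion preserves Cartesian arrows. A subfibration of trivial objects is a subfibration $\mathit{Triv}\colon\mathit{Triv}_t\to\mathit{Triv}_b$ of $P$ that is globally full and replete; objects of $\mathit{Triv}_t$, $\mathit{Triv}_b$ are called trivial. Coverings. A covering of an object $C$ is a set of arrows with codomain $C$; $S$ refines $R$ (coverings of the same object) if each arrow of $S$ factors through some arrow of $R$. A covering function $J$ on a category assigns to each object $C$ a class $J(C)$ of coverings of $C$. Axioms: (M) $\{1_C\}\in J(C)$ for all $C$; (C) given a $J$-covering $R$ of $C$ and $f\colon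 B\to C$, there is a $J$-covering $S$ of $B$ such that $\{f\circ g\mid g\in S\}$ refines $R$; (L) given a $J$-covering $R$ and for each $f\in R$ a $J$-covering $R_f$ of $\mathrm{dom}\, f$, the covering $\bigcup_{f\in R}\{f\circ g\mid g\in R_f\}$ is refined by a $J$-covering. Local triviality. Let $P$ be a fibration, $J$ a covering function on $\mathcal{B}$. $B\in\mathcal{B}$ is locally trivial for a covering $R$ of $B$ if all domains of arrows of $R$ are trivial; $E\in\mathcal{E}$ is locally trivial for a covering $R$ of $P(E)$ if the inverse images $f^*E$, $f\in R$, are all trivial. Locally trivial means locally trivial for some $J$-covering. $\mathit{Loc}\colon\mathit{Loc}_t\to\mathit{Loc}_b$ is the restriction of $P$ to the full subcategories of locally trivial objects. $J_l$ is the covering function on $\mathit{Loc}_b$ whose coverings are the $J$-coverings all of whose arrows have trivial domains. A fibred site with trivial objects $(P,J,\mathit{Triv})$ consists of a fibration $P$, a covering function $J$ on $\mathcal{B}$ satisfying (M), and a subfibration of trivial objects $\mathit{Triv}\subset P$, such that $J_l$ satisfies (C). In that case $\mathit{Loc}$ is a subfibration of $P$. Exactness. An exact category (Quillen) is an additive category $\mathcal{C}$ that is a full additive subcategory of some abelian category $\mathcal{D}$, closed under extensions in $\mathcal{D}$ (if $A\to B\to C$ is short exact in $\mathcal{D}$ with $A,C$ isomorphic to objects of $\mathcal{C}$, then $B$ is isomorphic to an object of $\mathcal{C}$), together with the class of all short exact sequences of $\mathcal{D}$ with objects in $\mathcal{C}$ (the admissible ones). An abelian category is exact with all its short exact sequences.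 An exact subcategory of an exact category is a full additive subcategory closed under extensions in it (for admissible short exact sequences), equipped with all admissible short exact sequences with objects in the subcategory. A functor between exact categories is exact if it is additive and preserves admissible short exact sequences. An abelian fibration is a fibration whose fibres are abelian and whose inverse image functors are additive. An exact fibration is a fibration with additive inverse image functors whose fibres are endowed with exact structures (the inverse image functors need not be exact). An exact subfibration of an exact fibration is a subfibration whose fibres are exact subcategories of the corresponding fibres. For an exact fibration $Q$ (such as $P$, $\mathit{Triv}$, $\mathit{Loc}$): a morphism $f$ of $Q_b$ is flat in $Q$ if its inverse image functor $f^*$ between the fibres of $Q$ is exact; a covering is flat in $Q$ if all its arrows are flat in $Q$; a covering $R$ of $B\in Q_b$ is faithfully flat in $Q$ if the family $\{f^*\mid f\in R\}$ of inverse image functors of $Q$ collectively preserves and reflects (admissible) short exact sequences, i.e. a sequence $s=(E'\to E\to E'')$ in $Q_B$ is an admissible short exact sequence if and only if $f^*(s)$ is one for every $f\in R$. An abelian fibred site with trivial objects is a fibred site with trivial objects $(P,J,\mathit{Triv})$ such that: $P$ is an abelian fibration; $\mathit{Triv}\subset P$ is an exact subfibration; $J_l$-coverings are flat in $P$; and $J_l$ satisfies (L). In that case $\mathit{Loc}$ is an exact subfibration of $P$. *)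

(* Defs.v *)
From Stdlib Require Import ProofIrrelevance ClassicalEpsilon.

Set Implicit Arguments.
Unset Strict Implicit.
Unset Printing Implicit Defensive.

Declare Scope cat_scope.
Delimit Scope cat_scope with cat.
Local Open Scope cat_scope.

(** * Categories and functors *)

Record Category := {
  ob :> Type;
  hom : ob -> ob -> Type;
  idm : forall a, hom a a;
  comp : forall a b c, hom b c -> hom a b -> hom a c;
  comp_id_l : forall a b (f : hom a b), comp (idm b) f = f;
  comp_id_r : forall a b (f : hom a b), comp f (idm a) = f;
  comp_assoc : forall a b c d (f : hom c d) (g : hom b c) (h : hom a b),
    comp f (comp g h) = comp (comp f g) h
}.
Arguments hom {c} a b : rename.
Arguments idm {c} a : rename.
Arguments comp {c a b c0} f g : rename.
Notation "g ∘ f" := (comp g f) (at level 40, left associativity) : cat_scope.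

Definition isomorphic (C : Category) (a b : C) : Prop :=
  exists (f : hom a b) (g : hom b a), g ∘ f = idm a /\ f ∘ g = idm b.

Definition mono (C : Category) (a b : C) (f : hom a b) : Prop :=
  forall c (g h : hom c a), f ∘ g = f ∘ h -> g = h.

Definition epi (C : Category) (a b : C) (f : hom a b) : Prop :=
  forall c (g h : hom b c), g ∘ f = h ∘ f -> g = h.

Definition eqhom (C : Category) (a b : C) (e : a = b) : hom a b :=
  match e with eq_refl => idm a end.

Record Functor (C D : Category) := {
  fob :> C -> D;
  fhom : forall a b, hom a b -> hom (fob a) (fob b);
  fhom_id : forall a, fhom (idm a) = idm (fob a);
  fhom_comp : forall a b c (g : hom b c) (f : hom a b),
    fhom (g ∘ f) = fhom g ∘ fhom f
}.
Arguments fhom {C D} F {a b} f : rename.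

Definition full (C D : Category) (F : Functor C D) : Prop :=
  forall a b (g : hom (F a) (F b)), exists f : hom a b, fhom F f = g.

Definition faithful (C D : Category) (F : Functor C D) : Prop :=
  forall a b (f g : hom a b), fhom F f = fhom F g -> f = g.

(** * Subcategories and subfunctors *)

Record Subcategory (C : Category) := {
  sub_ob : C -> Prop;
  sub_hom : forall a b : C, hom a b -> Prop;
  sub_dom : forall a b (f : hom a b), sub_hom f -> sub_ob a;
  sub_cod : forall a b (f : hom a b), sub_hom f -> sub_ob b;
  sub_id : forall a, sub_ob a -> sub_hom (idm a);
  sub_comp : forall a b c (g : hom b c) (f : hom a b),
    sub_hom g -> sub_hom f -> sub_hom (g ∘ f)
}.
Arguments sub_hom {C} s {a b} f.

Definition full_sub (C : Category) (S : Subcategory C) : Prop :=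
  forall a b (f : hom a b), sub_ob S a -> sub_ob S b -> sub_hom S f.

Lemma sig_eq (A : Type) (Q : A -> Prop) (x y : sig Q) :
  proj1_sig x = proj1_sig y -> x = y.
Proof. apply eq_sig_hprop; intros; apply proof_irrelevance. Qed.

Definition subcat (C : Category) (S : Subcategory C) : Category.
Proof.
refine {|
  ob := {a : C | sub_ob S a};
  hom := fun a b => {f : hom (proj1_sig a) (proj1_sig b) | sub_hom S f};
  idm := fun a => exist _ (idm (proj1_sig a)) (sub_id (proj2_sig a));
  comp := fun a b c g f =>
    exist _ (proj1_sig g ∘ proj1_sig f) (sub_comp (proj2_sig g) (proj2_sig f))
|}.
- intros; apply sig_eq, comp_id_l.
- intros; apply sig_eq, comp_id_r.
- intros; apply sig_eq, comp_assoc.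
Defined.

Definition full_subcategory (C : Category) (Q : C -> Prop) : Subcategory C.
Proof.
refine {| sub_ob := Q; sub_hom := fun a b _ => Q a /\ Q b |}; tauto.
Defined.

Record Subfunctor (E B : Category) (P : Functor E B) := {
  top : Subcategory E;
  bot : Subcategory B;
  restr_ob : forall x, sub_ob top x -> sub_ob bot (P x);
  restr_hom : forall x y (u : hom x y), sub_hom top u -> sub_hom bot (fhom P u)
}.

Definition subfun (E B : Category) (P : Functor E B) (Q : Subfunctor P) :
  Functor (subcat (top Q)) (subcat (bot Q)).
Proof.
refine (@Build_Functor (subcat (top Q)) (subcat (bot Q))
  (fun x => exist _ (P (proj1_sig x)) (restr_ob (proj2_sig x)))
  (fun x y u => exist _ (fhom P (proj1_sig u)) (restr_hom (proj2_sig u))) _ _).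
- intros; apply sig_eq, fhom_id.
- intros; apply sig_eq, fhom_comp.
Defined.

Definition globally_full (E B : Category) (P : Functor E B) (Q : Subfunctor P) :
  Prop := full_sub (top Q) /\ full_sub (bot Q).

(** * Fibres *)

(** [over px py u f]: the arrow [u] lies over [f], up to the identifications
    [px], [py] of the endpoints. *)
Definition over (E B : Category) (P : Functor E B) (x y : E) (a b : B)
  (px : P x = a) (py : P y = b) (u : hom x y) (f : hom a b) : Prop :=
  eqhom py ∘ fhom P u = f ∘ eqhom px.

Lemma over_id (E B : Category) (P : Functor E B) (x : E) (a : B) (px : P x = a) :
  over px px (idm x) (idm a).
Proof. now unfold over; rewrite fhom_id, comp_id_l, comp_id_r. Qed.

Lemma over_comp (E B : Category) (P : Functor E B) (x y z : E) (a b c : B)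
  (px : P x = a) (py : P y = b) (pz : P z = c) (v : hom y z) (u : hom x y)
  (g : hom b c) (f : hom a b) :
  over py pz v g -> over px py u f -> over px pz (v ∘ u) (g ∘ f).
Proof.
unfold over; intros Hv Hu.
now rewrite fhom_comp, comp_assoc, Hv, <- comp_assoc, Hu, comp_assoc.
Qed.

Lemma over_comp_id (E B : Category) (P : Functor E B) (x y z : E) (a : B)
  (px : P x = a) (py : P y = a) (pz : P z = a) (v : hom y z) (u : hom x y) :
  over py pz v (idm a) -> over px py u (idm a) -> over px pz (v ∘ u) (idm a).
Proof.
intros Hv Hu; rewrite <- (comp_id_l (idm a)); exact (over_comp Hv Hu).
Qed.

Definition fibre (E B : Category) (P : Functor E B) (b : B) : Category.
Proof.
refine {|
  ob := {x : E | P x = b};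
  hom := fun x y => {u : hom (proj1_sig x) (proj1_sig y) |
                      over (proj2_sig x) (proj2_sig y) u (idm b)};
  idm := fun x => exist _ (idm (proj1_sig x)) (over_id (proj2_sig x));
  comp := fun x y z v u =>
    exist _ (proj1_sig v ∘ proj1_sig u)
            (over_comp_id (proj2_sig v) (proj2_sig u))
|}.
- intros; apply sig_eq, comp_id_l.
- intros; apply sig_eq, comp_id_r.
- intros; apply sig_eq, comp_assoc.
Defined.

Lemma eqhom_subcat (C : Category) (S : Subcategory C) (a b : subcat S)
  (e : a = b) : proj1_sig (eqhom e) = eqhom (f_equal (@proj1_sig _ _) e).
Proof. now destruct e. Qed.

Lemma over_subfun (E B : Category) (P : Functor E B) (Q : Subfunctor P)
  (x y : subcat (top Q)) (a b : subcat (bot Q))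
  (px : subfun Q x = a) (py : subfun Q y = b) (u : hom x y) (f : hom a b) :
  over px py u f <->
  over (P := P) (f_equal (@proj1_sig _ _) px) (f_equal (@proj1_sig _ _) py)
    (proj1_sig u) (proj1_sig f).
Proof.
destruct px, py; unfold over; cbn; split; intros H.
- exact (f_equal (@proj1_sig _ _) H).
- apply sig_eq; exact H.
Qed.

Definition fibre_incl (E B : Category) (P : Functor E B) (Q : Subfunctor P)
  (b : subcat (bot Q)) : Functor (fibre (subfun Q) b) (fibre P (proj1_sig b)).
Proof.
refine (@Build_Functor (fibre (subfun Q) b) (fibre P (proj1_sig b))
  (fun x => exist _ (proj1_sig (proj1_sig x))
              (f_equal (@proj1_sig _ _) (proj2_sig x)))
  (fun x y u => exist _ (proj1_sig (proj1_sig u))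
              (proj1 (over_subfun _ _ _ _) (proj2_sig u))) _ _).
- intros; apply sig_eq; reflexivity.
- intros; apply sig_eq; reflexivity.
Defined.

Definition replete (E B : Category) (P : Functor E B) (Q : Subfunctor P) : Prop :=
  forall (b : B) (x y : fibre P b), isomorphic x y ->
    sub_ob (top Q) (proj1_sig x) -> sub_ob (top Q) (proj1_sig y).

Lemma fibre_incl_faithful (E B : Category) (P : Functor E B) (Q : Subfunctor P)
  (b : subcat (bot Q)) : faithful (fibre_incl b).
Proof.
intros x y u v H; apply sig_eq, sig_eq; exact (f_equal (@proj1_sig _ _) H).
Qed.

Lemma fibre_incl_full (E B : Category) (P : Functor E B) (Q : Subfunctor P)
  (HQ : globally_full Q) (b : subcat (bot Q)) : full (fibre_incl b).
Proof.
intros x y u.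
pose (u' := exist _ (proj1_sig u)
              (proj1 HQ _ _ (proj1_sig u)
                 (proj2_sig (proj1_sig x)) (proj2_sig (proj1_sig y)))
            : hom (proj1_sig x) (proj1_sig y)).
exists (exist _ u'
  (proj2 (over_subfun (proj2_sig x) (proj2_sig y) u' (idm b)) (proj2_sig u))).
now apply sig_eq.
Qed.

(** * Fibrations *)

Definition cartesian (E B : Category) (P : Functor E B) (x y : E) (u : hom x y) :
  Prop :=
  forall z (v : hom z y) (g : hom (P z) (P x)), fhom P u ∘ g = fhom P v ->
    exists! w : hom z x, fhom P w = g /\ u ∘ w = v.

Definition fibration (E B : Category) (P : Functor E B) : Prop :=
  forall (y : E) (a : B) (f : hom a (P y)),
    exists (x : E) (px : P x = a) (u : hom x y),
      cartesian P u /\ over px eq_refl u f.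

Definition subfibration (E B : Category) (P : Functor E B) (Q : Subfunctor P) :
  Prop :=
  fibration (subfun Q) /\
  forall x y (u : hom x y), cartesian (subfun Q) u -> cartesian P (proj1_sig u).

Definition subfibration_of_trivial_objects (E B : Category) (P : Functor E B)
  (Triv : Subfunctor P) : Prop :=
  subfibration Triv /\ globally_full Triv /\ replete Triv.

(** An inverse image functor along [f], defined only up to natural
    isomorphism: a choice of Cartesian liftings of [f] with its induced action
    on vertical arrows. *)
Record InverseImage (E B : Category) (P : Functor E B) (a b : B) (f : hom a b) :=
{
  inv_fun :> Functor (fibre P b) (fibre P a);
  inv_lift : forall x : fibre P b, hom (proj1_sig (inv_fun x)) (proj1_sig x);
  inv_cartesian : forall x, cartesian P (inv_lift x);
  inv_over : forall x,
    over (proj2_sig (inv_fun x)) (proj2_sig x) (inv_lift x) f;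
  inv_natural : forall x y (u : hom x y),
    inv_lift y ∘ proj1_sig (fhom inv_fun u) = proj1_sig u ∘ inv_lift x
}.

(** * Coverings *)

Definition Covering (C : Category) (c : C) : Type :=
  forall a : C, hom a c -> Prop.

Definition refines (C : Category) (c : C) (S R : Covering c) : Prop :=
  forall a (f : hom a c), S a f ->
    exists a' (f' : hom a' c) (h : hom a a'), R a' f' /\ f = f' ∘ h.

Inductive id_covering (C : Category) (c : C) : Covering c :=
| id_covering_intro : id_covering (idm c).

Definition post_covering (C : Category) (b c : C) (f : hom b c) (S : Covering b) :
  Covering c :=
  fun a h => exists g : hom a b, S a g /\ h = f ∘ g.

Definition comp_covering (C : Category) (c : C) (R : Covering c)
  (S : forall b (f : hom b c), R b f -> Covering b) : Covering c :=
  fun a h => exists b (f : hom b c) (r : R b f), post_covering f (S b f r) h.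

Definition CoveringFunction (C : Category) : Type :=
  forall c : C, Covering c -> Prop.

Definition axiom_M (C : Category) (J : CoveringFunction C) : Prop :=
  forall c : C, J c (@id_covering C c).

Definition axiom_C (C : Category) (J : CoveringFunction C) : Prop :=
  forall (c : C) (R : Covering c), J c R ->
  forall (b : C) (f : hom b c),
    exists S : Covering b, J b S /\ refines (post_covering f S) R.

Definition axiom_L (C : Category) (J : CoveringFunction C) : Prop :=
  forall (c : C) (R : Covering c), J c R ->
  forall S : forall b (f : hom b c), R b f -> Covering b,
    (forall b (f : hom b c) (r : R b f), J b (S b f r)) ->
    exists T : Covering c, J c T /\ refines T (comp_covering S).

Definition image_covering (C : Category) (S : Subcategory C) (c : subcat S)
  (R : Covering c) : Covering (proj1_sig c) :=
  fun a f => exists (sa : sub_ob S a) (sf : sub_hom S f),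
    R (exist _ a sa) (exist _ f sf).

(** * Local triviality *)

Definition locally_trivial_base (E B : Category) (P : Functor E B)
  (J : CoveringFunction B) (Triv : Subfunctor P) (b : B) : Prop :=
  exists R : Covering b, J b R /\
    forall a (f : hom a b), R a f -> sub_ob (bot Triv) a.

(** Inverse images are unique up to vertical isomorphism, so for replete [Triv]
    "the" inverse image is trivial as soon as one is. *)
Definition trivial_inverse_image (E B : Category) (P : Functor E B)
  (Triv : Subfunctor P) (y : E) (a : B) (f : hom a (P y)) : Prop :=
  exists (x : E) (px : P x = a) (u : hom x y),
    cartesian P u /\ over px eq_refl u f /\ sub_ob (top Triv) x.

Definition locally_trivial (E B : Category) (P : Functor E B)
  (J : CoveringFunction B) (Triv : Subfunctor P) (y : E) : Prop :=
  exists R : Covering (P y), J (P y) R /\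
    forall a (f : hom a (P y)), R a f -> trivial_inverse_image Triv f.

Lemma locally_trivial_restr (E B : Category) (P : Functor E B)
  (J : CoveringFunction B) (Triv : Subfunctor P) (y : E) :
  locally_trivial J Triv y -> locally_trivial_base J Triv (P y).
Proof.
intros [R [JR HR]]; exists R; split; [exact JR|].
intros a f r; destruct (HR a f r) as [x [px [u [_ [_ tx]]]]].
rewrite <- px; exact (restr_ob tx).
Qed.

Definition Loc (E B : Category) (P : Functor E B) (J : CoveringFunction B)
  (Triv : Subfunctor P) : Subfunctor P.
Proof.
refine {|
  top := full_subcategory (locally_trivial J Triv);
  bot := full_subcategory (locally_trivial_base J Triv)
|}.
- exact (@locally_trivial_restr _ _ P J Triv).
- intros x y u [hx hy]; split; now apply locally_trivial_restr.
Defined.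

Lemma Loc_globally_full (E B : Category) (P : Functor E B)
  (J : CoveringFunction B) (Triv : Subfunctor P) : globally_full (Loc J Triv).
Proof. now split; split. Qed.

Definition J_l (E B : Category) (P : Functor E B) (J : CoveringFunction B)
  (Triv : Subfunctor P) : CoveringFunction (subcat (bot (Loc J Triv))) :=
  fun c R => J (proj1_sig c) (image_covering R) /\
    forall a (f : hom a c), R a f -> sub_ob (bot Triv) (proj1_sig a).
Arguments J_l {E B P} J Triv [c] R.

Record fibred_site (E B : Category) (P : Functor E B) (J : CoveringFunction B)
  (Triv : Subfunctor P) : Prop := {
  site_fibration : fibration P;
  site_M : axiom_M J;
  site_Triv : subfibration_of_trivial_objects Triv;
  site_C : axiom_C (J_l J Triv)
}.

(** * Additive and abelian categories *)

Record Preadditive (C : Category) := {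
  zero : forall a b : C, hom a b;
  add : forall a b : C, hom a b -> hom a b -> hom a b;
  opp : forall a b : C, hom a b -> hom a b;
  addA : forall a b (f g h : hom a b), add f (add g h) = add (add f g) h;
  addC : forall a b (f g : hom a b), add f g = add g f;
  add0 : forall a b (f : hom a b), add (zero a b) f = f;
  addN : forall a b (f : hom a b), add (opp f) f = zero a b;
  comp_addl : forall a b c (g h : hom b c) (f : hom a b),
    add g h ∘ f = add (g ∘ f) (h ∘ f);
  comp_addr : forall a b c (g : hom b c) (f h : hom a b),
    g ∘ add f h = add (g ∘ f) (g ∘ h)
}.
Arguments zero {C} p a b.
Arguments add {C} p {a b} f g.
Arguments opp {C} p {a b} f.

Definition zero_object (C : Category) (z : C) : Prop :=
  forall a : C, (exists! f : hom a z, True) /\ (exists! f : hom z a, True).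

Definition biproduct (C : Category) (A : Preadditive C) (a b s : C) : Prop :=
  exists (i : hom a s) (j : hom b s) (p : hom s a) (q : hom s b),
    p ∘ i = idm a /\ q ∘ j = idm b /\
    q ∘ i = zero A a b /\ p ∘ j = zero A b a /\
    add A (i ∘ p) (j ∘ q) = idm s.

Definition additive_category (C : Category) (A : Preadditive C) : Prop :=
  (exists z : C, zero_object z) /\
  forall a b : C, exists s : C, biproduct A a b s.

Definition is_kernel (C : Category) (A : Preadditive C) (k a b : C)
  (i : hom k a) (f : hom a b) : Prop :=
  f ∘ i = zero A k b /\
  forall x (g : hom x a), f ∘ g = zero A x b -> exists! h : hom x k, i ∘ h = g.

Definition is_cokernel (C : Category) (A : Preadditive C) (a b q : C)
  (p : hom b q) (f : hom a b) : Prop :=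
  p ∘ f = zero A a q /\
  forall x (g : hom b x), g ∘ f = zero A a x -> exists! h : hom q x, h ∘ p = g.

Definition abelian (C : Category) (A : Preadditive C) : Prop :=
  additive_category A /\
  (forall (a b : C) (f : hom a b), exists k (i : hom k a), is_kernel A i f) /\
  (forall (a b : C) (f : hom a b), exists q (p : hom b q), is_cokernel A p f) /\
  (forall (a b : C) (i : hom a b), mono i ->
     exists c (f : hom b c), is_kernel A i f) /\
  (forall (a b : C) (p : hom a b), epi p ->
     exists c (f : hom c a), is_cokernel A p f).

Definition short_exact (C : Category) (A : Preadditive C) (a b c : C)
  (i : hom a b) (p : hom b c) : Prop :=
  is_kernel A i p /\ is_cokernel A p i.

Definition additive_functor (C D : Category) (A : Preadditive C)
  (A' : Preadditive D) (F : Functor C D) : Prop :=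
  forall a b (f g : hom a b), fhom F (add A f g) = add A' (fhom F f) (fhom F g).

(** * Exact categories *)

(** The data of an exact category, on which exactness of functors depends. The
    instances used for [P], [Triv] and [Loc] are the structure of an abelian
    category and those induced on full subcategories of abelian categories; see
    [quillen_exact] and [induced_quillen]. *)
Record ExactData (C : Category) := {
  preadd :> Preadditive C;
  admissible : forall a b c : C, hom a b -> hom b c -> Prop
}.
Arguments admissible {C} e {a b c} i p.

Definition abelian_exact (C : Category) (A : Preadditive C) : ExactData C :=
  {| preadd := A; admissible := @short_exact C A |}.

Definition exact_functor (C D : Category) (X : ExactData C) (Y : ExactData D)
  (F : Functor C D) : Prop :=
  additive_functor X Y F /\
  forall a b c (i : hom a b) (p : hom b c),
    admissible X i p -> admissible Y (fhom F i) (fhom F p).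

Section Induced.
Variables (C D : Category) (F : Functor C D) (Ffull : full F) (Ffaith : faithful F).

Definition lift_hom (a b : C) (g : hom (F a) (F b)) : hom a b :=
  proj1_sig (constructive_indefinite_description _ (@Ffull a b g)).

Lemma lift_homK a b (g : hom (F a) (F b)) : fhom F (lift_hom g) = g.
Proof.
exact (proj2_sig (constructive_indefinite_description _ (@Ffull a b g))).
Qed.

Definition induced_preadditive (A : Preadditive D) : Preadditive C.
Proof.
refine {|
  zero := fun a b => lift_hom (zero A (F a) (F b));
  add := fun a b f g => lift_hom (add A (fhom F f) (fhom F g));
  opp := fun a b f => lift_hom (opp A (fhom F f))
|}; intros; apply Ffaith; rewrite ?fhom_comp, ?lift_homK, ?fhom_comp.
- apply addA.
- apply addC.
- apply add0.
- apply addN.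
- apply comp_addl.
- apply comp_addr.
Defined.

Definition induced_exact (X : ExactData D) : ExactData C := {|
  preadd := induced_preadditive X;
  admissible := fun a b c i p => admissible X (fhom F i) (fhom F p)
|}.
End Induced.

(** [F] is the inclusion of [C] in the exact category [D]; being additive is
    expressed by [C] containing a zero object and binary biproducts of [D]. *)
Definition exact_subcategory (C D : Category) (X : ExactData D) (F : Functor C D) :
  Prop :=
  (full F /\ faithful F) /\
  (exists z : C, zero_object (F z)) /\
  (forall a b : C, exists s : C, biproduct X (F a) (F b) (F s)) /\
  (forall (a b c : D) (i : hom a b) (p : hom b c), admissible X i p ->
     (exists a' : C, isomorphic a (F a')) ->
     (exists c' : C, isomorphic c (F c')) ->
     exists b' : C, isomorphic b (F b')).

(** Quillen's definition, with the full subcategory given by its inclusion. *)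
Definition quillen_exact (C : Category) (X : ExactData C) : Prop :=
  exists (D : Category) (A : Preadditive D) (F : Functor C D),
    abelian A /\ exact_subcategory (abelian_exact A) F /\
    additive_functor X A F /\
    forall a b c (i : hom a b) (p : hom b c),
      admissible X i p <-> short_exact A (fhom F i) (fhom F p).

Lemma induced_quillen (C D : Category) (A : Preadditive D) (F : Functor C D)
  (Ffull : full F) (Ffaith : faithful F) :
  abelian A -> exact_subcategory (abelian_exact A) F ->
  quillen_exact (induced_exact Ffull Ffaith (abelian_exact A)).
Proof.
intros HA HF; exists D, A, F; split; [exact HA|split; [exact HF|split]].
- intros a b f g; apply lift_homK.
- intros; reflexivity.
Qed.

(** * Exact fibrations and flatness *)

Definition abelian_fibration (E B : Category) (P : Functor E B)
  (A : forall b : B, Preadditive (fibre P b)) : Prop :=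
  fibration P /\
  (forall b, abelian (A b)) /\
  forall a b (f : hom a b) (I : InverseImage P f), additive_functor (A b) (A a) I.

Definition exact_subfibration (E B : Category) (P : Functor E B)
  (X : forall b : B, ExactData (fibre P b)) (Q : Subfunctor P) : Prop :=
  subfibration Q /\
  forall b : subcat (bot Q), exact_subcategory (X (proj1_sig b)) (fibre_incl b).

Definition sub_exact (E B : Category) (P : Functor E B)
  (X : forall b : B, ExactData (fibre P b)) (Q : Subfunctor P)
  (HQ : globally_full Q) (b : subcat (bot Q)) : ExactData (fibre (subfun Q) b) :=
  induced_exact (fibre_incl_full HQ (b := b))
    (@fibre_incl_faithful _ _ P Q b) (X (proj1_sig b)).

(** In a fibration inverse image functors exist and any two along [f] are
    naturally isomorphic, so the universal quantification over them amounts to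
    the same as choosing one. *)
Definition flat (E B : Category) (P : Functor E B)
  (X : forall b : B, ExactData (fibre P b)) (a b : B) (f : hom a b) : Prop :=
  inhabited (InverseImage P f) /\
  forall I : InverseImage P f, exact_functor (X b) (X a) I.

Definition faithfully_flat (E B : Category) (P : Functor E B)
  (X : forall b : B, ExactData (fibre P b)) (b : B) (R : Covering b) : Prop :=
  (forall a (f : hom a b), R a f -> inhabited (InverseImage P f)) /\
  forall I : (forall a (f : hom a b), R a f -> InverseImage P f),
  forall (x y z : fibre P b) (i : hom x y) (p : hom y z),
    admissible (X b) i p <->
    forall a (f : hom a b) (r : R a f),
      admissible (X a) (fhom (I a f r) i) (fhom (I a f r) p).

Record abelian_fibred_site (E B : Category) (P : Functor E B)
  (J : CoveringFunction B) (Triv : Subfunctor P)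
  (A : forall b : B, Preadditive (fibre P b)) : Prop := {
  absite_site : fibred_site J Triv;
  absite_abelian : abelian_fibration A;
  absite_Triv : exact_subfibration (fun b => abelian_exact (A b)) Triv;
  absite_flat : forall (c : subcat (bot (Loc J Triv))) (R : Covering c),
    J_l J Triv R -> forall a (f : hom a c), R a f ->
    flat (fun b => abelian_exact (A b)) (proj1_sig f);
  absite_L : axiom_L (J_l J Triv)
}.

Definition Triv_globally_full (E B : Category) (P : Functor E B)
  (J : CoveringFunction B) (Triv : Subfunctor P)
  (A : forall b : B, Preadditive (fibre P b)) (H : abelian_fibred_site J Triv A) :
  globally_full Triv := proj1 (proj2 (site_Triv (absite_site H))).

Definition exact_P (E B : Category) (P : Functor E B)
  (A : forall b : B, Preadditive (fibre P b)) (b : B) : ExactData (fibre P b) :=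
  abelian_exact (A b).

Definition exact_Triv (E B : Category) (P : Functor E B)
  (J : CoveringFunction B) (Triv : Subfunctor P)
  (A : forall b : B, Preadditive (fibre P b)) (H : abelian_fibred_site J Triv A)
  (b : subcat (bot Triv)) : ExactData (fibre (subfun Triv) b) :=
  sub_exact (exact_P A) (Triv_globally_full H) b.

Definition exact_Loc (E B : Category) (P : Functor E B)
  (J : CoveringFunction B) (Triv : Subfunctor P)
  (A : forall b : B, Preadditive (fibre P b))
  (b : subcat (bot (Loc J Triv))) : ExactData (fibre (subfun (Loc J Triv)) b) :=
  sub_exact (exact_P A) (Loc_globally_full J Triv) b.

(* Main.v *)
(* An exact sequence s of locally trivial objects over b consists of trivial
   objects along one J_l-covering T of b, by (C) and (L). Given f : a -> b, (C)
   yields a J_l-covering S of a with f g = t h for each g in S and some t in T.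
   Then g^* f^* s is isomorphic to h^* t^* s, which is exact since t is flat and
   h is a morphism of trivial objects; so f^* s is exact, S being faithfully
   flat. *)

Require Import Defs.
From Stdlib Require Import ClassicalEpsilon.
From Stdlib Require Import FunctionalExtensionality PropExtensionality.

Local Open Scope cat_scope.

(** * Transport of short exactness along isomorphisms of sequences *)

Section Preadditive.
Context {C : Category} (A : Preadditive C).

Lemma add_idem_zero {a b : C} (f : hom a b) : add A f f = f -> f = zero A a b.
Proof.
intros H.
now rewrite <- (add0 A f), <- (addN A f), <- addA, H.
Qed.

Lemma comp_zero_l {a b c : C} (f : hom a b) : zero A b c ∘ f = zero A a c.
Proof. apply add_idem_zero; now rewrite <- comp_addl, add0. Qed.

Lemma comp_zero_r {a b c : C} (g : hom b c) : g ∘ zero A a b = zero A a c.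
Proof. apply add_idem_zero; now rewrite <- comp_addr, add0. Qed.

(* An isomorphism [(s, t, r)] of sequences from [(i, p)] to [(i', p')], with
   inverse [(s', t', r')]. *)
Context {a b c a' b' c' : C} {i : hom a b} {p : hom b c}
  {i' : hom a' b'} {p' : hom b' c'}
  {s : hom a a'} {t : hom b b'} {r : hom c c'}
  {s' : hom a' a} {t' : hom b' b} {r' : hom c' c}.
Hypotheses (ss : s ∘ s' = idm a') (ss' : s' ∘ s = idm a)
  (tt : t ∘ t' = idm b') (tt' : t' ∘ t = idm b)
  (rr : r ∘ r' = idm c') (rr' : r' ∘ r = idm c)
  (Hi : t ∘ i = i' ∘ s) (Hp : r ∘ p = p' ∘ t).

Lemma iso_square_inv_l : i ∘ s' = t' ∘ i'.
Proof using ss tt' Hi.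
rewrite <- (comp_id_l (i ∘ s')), <- tt', <- comp_assoc, (comp_assoc t), Hi.
now rewrite <- comp_assoc, ss, comp_id_r.
Qed.

Lemma iso_square_inv_r : p ∘ t' = r' ∘ p'.
Proof using tt rr' Hp.
rewrite <- (comp_id_l (p ∘ t')), <- rr', <- comp_assoc, (comp_assoc r), Hp.
now rewrite <- comp_assoc, tt, comp_id_r.
Qed.

Lemma iso_sequence_zero : p ∘ i = zero A a c -> p' ∘ i' = zero A a' c'.
Proof using ss Hi Hp.
intros H.
rewrite <- (comp_id_r i'), <- ss, (comp_assoc i'), <- Hi, !comp_assoc, <- Hp.
now rewrite <- (comp_assoc r), H, comp_zero_r, comp_zero_l.
Qed.

(** A test arrow into [b'] is moved to [b] by [t'] and factored there; the factor is then moved to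
    [a'] by [s]. *)
Lemma is_kernel_iso : is_kernel A i p -> is_kernel A i' p'.
Proof using ss ss' tt tt' rr' Hi Hp.
intros [H0 H]; split; [now apply iso_sequence_zero|].
intros x g Hg.
destruct (H x (t' ∘ g)) as [h [Hh Uh]].
{ rewrite comp_assoc, iso_square_inv_r, <- comp_assoc, Hg.
  apply comp_zero_r. }
exists (s ∘ h); split.
- now rewrite comp_assoc, <- Hi, <- comp_assoc, Hh, comp_assoc, tt, comp_id_l.
- intros k Hk.
  rewrite (Uh (s' ∘ k)), comp_assoc, ss, comp_id_l; [reflexivity|].
  now rewrite comp_assoc, iso_square_inv_l, <- comp_assoc, Hk.
Qed.

Lemma is_cokernel_iso : is_cokernel A p i -> is_cokernel A p' i'.
Proof using ss tt tt' rr rr' Hi Hp.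
intros [H0 H]; split; [now apply iso_sequence_zero|].
intros x g Hg.
destruct (H x (g ∘ t)) as [h [Hh Uh]].
{ rewrite <- comp_assoc, Hi, comp_assoc, Hg; apply comp_zero_l. }
exists (h ∘ r'); split.
- now rewrite <- comp_assoc, <- iso_square_inv_r, comp_assoc, Hh,
    <- comp_assoc, tt, comp_id_r.
- intros k Hk.
  rewrite (Uh (k ∘ r)), <- comp_assoc, rr, comp_id_r; [reflexivity|].
  now rewrite <- comp_assoc, Hp, comp_assoc, Hk.
Qed.

Lemma short_exact_iso : short_exact A i p -> short_exact A i' p'.
Proof using ss ss' tt tt' rr rr' Hi Hp.
intros [K L]; split; [now apply is_kernel_iso|now apply is_cokernel_iso].
Qed.
End Preadditive.

(** Inverse image functors are data, while Cartesian liftings are only known to exist; choice passes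
    from the latter to the former. *)
Lemma choice_dependent {T : Type} {U : T -> Type}
  (R : forall t, U t -> Prop) :
  (forall t, exists u, R t u) -> exists f : forall t, U t, forall t, R t (f t).
Proof.
intros H.
exists (fun t => proj1_sig (constructive_indefinite_description _ (H t))).
intros t; apply proj2_sig.
Qed.

(** * Cartesian liftings between fibre objects and inverse images of sequences *)

Section CartesianLifts.
Context {E B : Category} {P : Functor E B}.

(** Fibre objects carry the identifications of their images under [P], so arrows over different
    composites can be compared without transport along equalities. *)
Definition hom_over {a b : B} (f : hom a b) (x : fibre P a) (y : fibre P b)
  (u : hom (proj1_sig x) (proj1_sig y)) : Prop :=
  over (proj2_sig x) (proj2_sig y) u f.

Definition cart_lift {a b : B} (f : hom a b) (x : fibre P a) (y : fibre P b)
  (u : hom (proj1_sig x) (proj1_sig y)) : Prop :=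
  cartesian P u /\ hom_over f x y u.

Lemma hom_over_comp {a b c : B} {f : hom b c} {g : hom a b}
  {x : fibre P a} {y : fibre P b} {z : fibre P c} {u v} :
  hom_over f y z u -> hom_over g x y v -> hom_over (f ∘ g) x z (u ∘ v).
Proof. apply over_comp. Qed.

Lemma hom_over_vert_l {a b : B} {f : hom a b} {x : fibre P a} {y z : fibre P b}
  {u} {v : hom y z} :
  hom_over f x y u -> hom_over f x z (proj1_sig v ∘ u).
Proof.
intros H; rewrite <- (comp_id_l f); exact (hom_over_comp (proj2_sig v) H).
Qed.

(** Substituting the endpoint equalities turns this into the universal property in [cartesian]. *)
Lemma cart_lift_factor {a b c : B} {f : hom b c} {g : hom a b}
  {x : fibre P b} {y : fibre P c} {z : fibre P a} {u v} :
  cart_lift f x y u -> hom_over (f ∘ g) z y v ->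
  exists! w, hom_over g z x w /\ u ∘ w = v.
Proof.
destruct x as [x px], y as [y py], z as [z pz]; subst.
unfold cart_lift, hom_over, over; cbn in *.
rewrite !comp_id_l, !comp_id_r; intros [Hc Hu] Hv.
destruct (Hc z v g) as [w [Hw Uw]]; [congruence|].
exists w; split.
- now rewrite comp_id_l.
- intros w'; rewrite comp_id_l; apply Uw.
Qed.

(** Converse of [cart_lift_factor]: any object [z] of [E] lies in the fibre over [P z] by [eq_refl],
    so these test arrows cover those of [cartesian]. *)
Lemma cart_lift_intro {b c : B} {f : hom b c}
  {x : fibre P b} {y : fibre P c} {u} :
  hom_over f x y u ->
  (forall (a : B) (g : hom a b) (z : fibre P a) v, hom_over (f ∘ g) z y v ->
     exists! w, hom_over g z x w /\ u ∘ w = v) ->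
  cart_lift f x y u.
Proof.
intros Hu H; split; [intros z v g Hg|exact Hu].
destruct x as [x px], y as [y py]; subst.
unfold hom_over, over in *; cbn in *.
rewrite comp_id_l, comp_id_r in Hu.
destruct (H (P z) g (exist _ z eq_refl) v) as [w [Hw Uw]]; cbn in *.
{ now rewrite comp_id_l, comp_id_r, <- Hu. }
rewrite comp_id_l, comp_id_r in Hw.
exists w; split; [exact Hw|].
intros w'; specialize (Uw w'); rewrite comp_id_l, comp_id_r in Uw; exact Uw.
Qed.

Lemma cart_lift_inj {a b c : B} {f : hom b c} {g : hom a b}
  {x : fibre P b} {y : fibre P c} {z : fibre P a} {u v w} :
  cart_lift f x y u -> hom_over g z x v -> hom_over g z x w ->
  u ∘ v = u ∘ w -> v = w.
Proof.
intros Hu Hv Hw e.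
destruct (cart_lift_factor Hu (hom_over_comp (proj2 Hu) Hw)) as [k [_ Uk]].
now rewrite <- (Uk v), <- (Uk w).
Qed.

Lemma cart_lift_vert_inj {a b : B} {f : hom a b}
  {x z : fibre P a} {y : fibre P b} {u} (v w : hom z x) :
  cart_lift f x y u -> u ∘ proj1_sig v = u ∘ proj1_sig w -> v = w.
Proof.
intros Hu e; apply sig_eq.
exact (cart_lift_inj Hu (proj2_sig v) (proj2_sig w) e).
Qed.

Lemma cart_lift_vert {a b : B} {f : hom a b}
  {x z : fibre P a} {y : fibre P b} {u v} :
  cart_lift f x y u -> hom_over f z y v ->
  exists w : hom z x, u ∘ proj1_sig w = v.
Proof.
intros Hu Hv; rewrite <- (comp_id_r f) in Hv.
destruct (cart_lift_factor Hu Hv) as [w [[Hw e] _]].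
now exists (exist _ w Hw).
Qed.

Lemma cart_lift_iso {a b : B} {f : hom a b} {x x' : fibre P a} {y : fibre P b}
  {u u'} :
  cart_lift f x y u -> cart_lift f x' y u' ->
  exists (s : hom x x') (s' : hom x' x),
    s ∘ s' = idm x' /\ s' ∘ s = idm x /\ u' ∘ proj1_sig s = u.
Proof.
intros Hu Hu'.
destruct (cart_lift_vert Hu' (proj2 Hu)) as [s es].
destruct (cart_lift_vert Hu (proj2 Hu')) as [s' es'].
exists s, s'; split; [|split; [|exact es]].
- apply (cart_lift_vert_inj _ _ Hu'); cbn.
  now rewrite comp_assoc, es, es', comp_id_r.
- apply (cart_lift_vert_inj _ _ Hu); cbn.
  now rewrite comp_assoc, es', es, comp_id_r.
Qed.

Lemma cart_lift_comp {a b c : B} {f : hom b c} {g : hom a b}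
  {x : fibre P a} {y : fibre P b} {z : fibre P c} {u v} :
  cart_lift f y z u -> cart_lift g x y v -> cart_lift (f ∘ g) x z (u ∘ v).
Proof.
intros Hu Hv; apply cart_lift_intro.
{ exact (hom_over_comp (proj2 Hu) (proj2 Hv)). }
intros d h w k Hk; rewrite <- comp_assoc in Hk.
destruct (cart_lift_factor Hu Hk) as [l [[Hl el] Ul]].
destruct (cart_lift_factor Hv Hl) as [m [[Hm em] Um]].
exists m; split.
- split; [exact Hm|]. now rewrite <- comp_assoc, em.
- intros m' [Hm' em']; apply Um; split; [exact Hm'|].
  symmetry; apply Ul; split; [exact (hom_over_comp (proj2 Hv) Hm')|].
  now rewrite comp_assoc.
Qed.

(** A vertical isomorphism is a Cartesian lifting of the identity, with factorizations given by its
    inverse; then [cart_lift_comp] applies. *)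
Lemma cart_lift_iso_comp {a b : B} {f : hom a b} {x x' : fibre P a}
  {y : fibre P b} {u} {s : hom x x'} {s' : hom x' x} :
  s ∘ s' = idm x' -> s' ∘ s = idm x -> cart_lift f x' y u ->
  cart_lift f x y (u ∘ proj1_sig s).
Proof.
intros ss ss' Hu; rewrite <- (comp_id_r f); apply (cart_lift_comp Hu).
apply cart_lift_intro; [exact (proj2_sig s)|].
intros d h w k Hk; rewrite comp_id_l in Hk.
apply (f_equal (@proj1_sig _ _)) in ss, ss'; cbn in ss, ss'.
exists (proj1_sig s' ∘ k); split.
- split; [exact (hom_over_vert_l Hk)|].
  now rewrite comp_assoc, ss, comp_id_l.
- intros k' [_ <-]; now rewrite comp_assoc, ss', comp_id_l.
Qed.

Lemma fibration_lift {a b : B} (HP : fibration P) (f : hom a b) (y : fibre P b) :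
  exists (x : fibre P a) u, cart_lift f x y u.
Proof.
destruct y as [y py]; subst; destruct (HP y a f) as [x [px [u Hu]]].
now exists (exist _ x px), u.
Qed.

Lemma inverse_image_inhabited {a b : B} (f : hom a b) :
  (forall y : fibre P b, exists (x : fibre P a) u, cart_lift f x y u) ->
  inhabited (InverseImage P f).
Proof.
intros HP.
destruct (choice_dependent
  (fun y (q : {x : fibre P a & hom (proj1_sig x) (proj1_sig y)}) =>
     cart_lift f (projT1 q) y (projT2 q))) as [L HL].
{ intros y; destruct (HP y) as [x [u Hu]]; now exists (existT _ x u). }
(* The index packs an arrow of the fibre with its endpoints, so one choice gives the action on all
   arrows. *)
destruct (choice_dependent
  (fun (q : {y : fibre P b & {z : fibre P b & hom y z}})
     (w : hom (projT1 (L (projT1 q))) (projT1 (L (projT1 (projT2 q))))) =>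
   projT2 (L (projT1 (projT2 q))) ∘ proj1_sig w =
     proj1_sig (projT2 (projT2 q)) ∘ projT2 (L (projT1 q)))) as [N HN].
{ intros [y [z v]].
  exact (cart_lift_vert (HL z) (hom_over_vert_l (proj2 (HL y)))). }
assert (HN' : forall y z v, projT2 (L z) ∘ proj1_sig (N (existT _ y (existT _ z v))) =
  proj1_sig v ∘ projT2 (L y)) by exact (fun y z v => HN (existT _ y (existT _ z v))).
unshelve refine (inhabits {|
  inv_fun := @Build_Functor (fibre P b) (fibre P a) (fun y => projT1 (L y))
    (fun y z v => N (existT _ y (existT _ z v))) _ _;
  inv_lift := fun y => projT2 (L y) |}).
(* The functor laws are checked after composition with a Cartesian lifting, where [HN'] computes
   both sides. *)
- intros y; apply (cart_lift_vert_inj _ _ (HL y)).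
  refine (eq_trans (HN' y y (idm y)) _); cbn.
  now rewrite comp_id_l, comp_id_r.
- intros x y z v w; apply (cart_lift_vert_inj _ _ (HL z)).
  refine (eq_trans (HN' x z (v ∘ w)) _); cbn.
  refine (eq_trans (eq_sym (comp_assoc _ _ _)) _).
  refine (eq_trans (f_equal (comp _) (eq_sym (HN' x y w))) _).
  refine (eq_trans (comp_assoc _ _ _) _).
  refine (eq_trans (f_equal (fun k => k ∘ _) (eq_sym (HN' y z v))) _).
  exact (eq_sym (comp_assoc _ _ _)).
- exact (fun y => proj1 (HL y)).
- exact (fun y => proj2 (HL y)).
- exact HN'.
Qed.

Lemma inv_cart_lift {a b : B} {f : hom a b} (I : InverseImage P f) (y : fibre P b) :
  cart_lift f (I y) y (inv_lift I y).
Proof. split; [apply inv_cartesian|apply inv_over]. Qed.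

(* [u] and [v] are meant to be Cartesian liftings of the same arrow; then [m']
   is the inverse image of [m]. *)
Definition pullback_hom {a b : B} {x y : fibre P b} {x' y' : fibre P a}
  (m : hom x y) (m' : hom x' y') u v : Prop :=
  v ∘ proj1_sig m' = proj1_sig m ∘ u.

(** Being an inverse image sequence is a relation, free of any chosen functor. Iterated inverse
    images and inverse images along the composite thus become instances of the same relation. *)
Definition pullback_seq {a b : B} (f : hom a b)
  {x y z : fibre P b} (i : hom x y) (p : hom y z)
  {x' y' z' : fibre P a} (i' : hom x' y') (p' : hom y' z') : Prop :=
  exists u v w, cart_lift f x' x u /\ cart_lift f y' y v /\ cart_lift f z' z w /\
    pullback_hom i i' u v /\ pullback_hom p p' v w.

Lemma pullback_seq_inv {a b : B} {f : hom a b} (I : InverseImage P f)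
  {x y z : fibre P b} (i : hom x y) (p : hom y z) :
  pullback_seq f i p (fhom I i) (fhom I p).
Proof.
exists (inv_lift I x), (inv_lift I y), (inv_lift I z).
repeat split; try apply inv_cartesian; try apply inv_over; apply inv_natural.
Qed.

Lemma pullback_hom_comp {a b c : B} {x y : fibre P c} {x' y' : fibre P b}
  {x'' y'' : fibre P a} {m : hom x y} {m' : hom x' y'} {m'' : hom x'' y''}
  {u v u' v'} :
  pullback_hom m m' u v -> pullback_hom m' m'' u' v' ->
  pullback_hom m m'' (u ∘ u') (v ∘ v').
Proof.
unfold pullback_hom; intros H H'.
now rewrite <- comp_assoc, H', !comp_assoc, H.
Qed.

Lemma pullback_seq_comp {a b c : B} {f : hom b c} {g : hom a b}
  {x y z : fibre P c} {i : hom x y} {p : hom y z}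
  {x' y' z' : fibre P b} {i' : hom x' y'} {p' : hom y' z'}
  {x'' y'' z'' : fibre P a} {i'' : hom x'' y''} {p'' : hom y'' z''} :
  pullback_seq f i p i' p' -> pullback_seq g i' p' i'' p'' ->
  pullback_seq (f ∘ g) i p i'' p''.
Proof.
intros [u [v [w [Hu [Hv [Hw [Hi Hp]]]]]]] [u' [v' [w' [Hu' [Hv' [Hw' [Hi' Hp']]]]]]].
exists (u ∘ u'), (v ∘ v'), (w ∘ w').
split; [|split; [|split; [|split]]].
- exact (cart_lift_comp Hu Hu').
- exact (cart_lift_comp Hv Hv').
- exact (cart_lift_comp Hw Hw').
- exact (pullback_hom_comp Hi Hi').
- exact (pullback_hom_comp Hp Hp').
Qed.

Lemma pullback_hom_iso {a b : B} {f : hom a b} {x y : fibre P b}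
  {x1 y1 x2 y2 : fibre P a} {m : hom x y} {m1 : hom x1 y1} {m2 : hom x2 y2}
  {u1 v1 u2 v2} {s : hom x1 x2} {t : hom y1 y2} :
  cart_lift f y2 y v2 ->
  pullback_hom m m1 u1 v1 -> pullback_hom m m2 u2 v2 ->
  u2 ∘ proj1_sig s = u1 -> v2 ∘ proj1_sig t = v1 -> t ∘ m1 = m2 ∘ s.
Proof.
intros Hv H1 H2 es et; apply (cart_lift_vert_inj _ _ Hv); cbn.
unfold pullback_hom in H1, H2.
now rewrite !comp_assoc, et, H2, H1, <- comp_assoc, es.
Qed.

(** Cartesian liftings of the same arrow with the same target have isomorphic domains, and these
    isomorphisms commute with the induced arrows, so the two sequences are isomorphic. *)
Lemma short_exact_pullback_seq {a b : B} (A : Preadditive (fibre P a)) {f : hom a b}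
  {x y z : fibre P b} {i : hom x y} {p : hom y z}
  {x1 y1 z1 : fibre P a} {i1 : hom x1 y1} {p1 : hom y1 z1}
  {x2 y2 z2 : fibre P a} {i2 : hom x2 y2} {p2 : hom y2 z2} :
  pullback_seq f i p i1 p1 -> pullback_seq f i p i2 p2 ->
  short_exact A i1 p1 -> short_exact A i2 p2.
Proof.
intros [u1 [v1 [w1 [Hu1 [Hv1 [Hw1 [Hi1 Hp1]]]]]]]
  [u2 [v2 [w2 [Hu2 [Hv2 [Hw2 [Hi2 Hp2]]]]]]].
destruct (cart_lift_iso Hu1 Hu2) as [s [s' [ss [ss' es]]]].
destruct (cart_lift_iso Hv1 Hv2) as [t [t' [tt [tt' et]]]].
destruct (cart_lift_iso Hw1 Hw2) as [r [r' [rr [rr' er]]]].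
exact (short_exact_iso A ss ss' tt tt' rr rr'
  (pullback_hom_iso Hv2 Hi1 Hi2 es et) (pullback_hom_iso Hw2 Hp1 Hp2 et er)).
Qed.

(** The liftings [u] and [v] need not be those chosen by [I]. Comparison arrows [s] and [t] express
    every inverse image of [k] as [t ∘ fhom I k ∘ s], which is additive in [k]. *)
Lemma pullback_hom_add {a b : B} {Aa : Preadditive (fibre P a)}
  {Ab : Preadditive (fibre P b)} {f : hom a b} (I : InverseImage P f)
  {x y : fibre P b} {x' y' : fibre P a} {m n : hom x y} {m' n' : hom x' y'} {u v} :
  additive_functor Ab Aa I -> cart_lift f x' x u -> cart_lift f y' y v ->
  pullback_hom m m' u v -> pullback_hom n n' u v ->
  pullback_hom (add Ab m n) (add Aa m' n') u v.
Proof.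
intros HI Hu Hv.
destruct (cart_lift_vert (inv_cart_lift I x) (proj2 Hu)) as [s es].
destruct (cart_lift_vert Hv (proj2 (inv_cart_lift I y))) as [t et].
assert (H : forall k : hom x y, pullback_hom k (t ∘ fhom I k ∘ s) u v).
{ intros k; unfold pullback_hom; cbn.
  now rewrite !comp_assoc, et, inv_natural, <- comp_assoc, es. }
assert (U : forall (k : hom x y) (k' : hom x' y'), pullback_hom k k' u v ->
  k' = t ∘ fhom I k ∘ s).
{ intros k k' Hk; apply (cart_lift_vert_inj _ _ Hv).
  unfold pullback_hom in Hk; rewrite Hk; symmetry; exact (H k). }
intros Hm Hn; rewrite (U _ _ Hm), (U _ _ Hn), <- comp_addl, <- comp_addr, <- HI.
apply H.
Qed.
End CartesianLifts.

(** * Comparison of Cartesian liftings and inverse images in a subfunctor and in [P] *)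

Section Subfunctors.
Context {E B : Category} {P : Functor E B} {Q : Subfunctor P}.

Lemma fibre_incl_ob (c : subcat (bot Q)) (w : fibre P (proj1_sig c)) :
  sub_ob (top Q) (proj1_sig w) -> exists w', fibre_incl c w' = w.
Proof.
destruct c as [c hc], w as [w pw]; cbn in *; subst c; intros tw.
unshelve eexists.
- exists (exist _ w tw); now apply sig_eq.
- now apply sig_eq.
Qed.

Lemma cart_lift_incl (HQ : forall x y (u : hom x y),
    cartesian (subfun Q) u -> cartesian P (proj1_sig u))
  {a b : subcat (bot Q)} {f : hom a b} {x : fibre (subfun Q) a}
  {y : fibre (subfun Q) b} {u} :
  cart_lift f x y u ->
  cart_lift (proj1_sig f) (fibre_incl a x) (fibre_incl b y) (proj1_sig u).
Proof.
intros [Hu Hf]; split; [now apply HQ|].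
exact (proj1 (over_subfun _ _ _ _) Hf).
Qed.

(** The factorizations that exist in [P] belong to [Q] by fullness, and uniqueness is inherited. *)
Lemma cart_lift_full (HQ : globally_full Q)
  {a b : subcat (bot Q)} {f : hom a b} {x : fibre (subfun Q) a}
  {y : fibre (subfun Q) b} {u} :
  cart_lift (proj1_sig f) (fibre_incl a x) (fibre_incl b y) u ->
  exists su, cart_lift f x y (exist _ u su).
Proof.
intros [Hu Hf].
pose (su := proj1 HQ _ _ u (proj2_sig (proj1_sig x)) (proj2_sig (proj1_sig y))).
exists su; split.
2: exact (proj2 (over_subfun (proj2_sig x) (proj2_sig y) (exist _ u su) f) Hf).
intros z v g Hg.
destruct (Hu (proj1_sig z) (proj1_sig v) (proj1_sig g)
  (f_equal (@proj1_sig _ _) Hg)) as [w [[Hw ew] Uw]].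
exists (exist _ w (proj1 HQ _ _ w (proj2_sig z) (proj2_sig (proj1_sig x)))).
split.
- split; apply sig_eq; [exact Hw|exact ew].
- intros w' [Hw' ew']; apply sig_eq, Uw; split.
  + exact (f_equal (@proj1_sig _ _) Hw').
  + exact (f_equal (@proj1_sig _ _) ew').
Qed.

(* A [Q]-Cartesian arrow is compared, inside [Q], with a [P]-Cartesian lifting
   of the same arrow that lies in [Q]. *)
Lemma cartesian_incl (HQ : globally_full Q)
  (HL : forall (a b : subcat (bot Q)) (f : hom a b) (y : fibre (subfun Q) b),
     exists (x : fibre (subfun Q) a) u,
       cart_lift (proj1_sig f) (fibre_incl a x) (fibre_incl b y) u) :
  forall x y (u : hom x y), cartesian (subfun Q) u -> cartesian P (proj1_sig u).
Proof.
intros x y u Hu.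
pose (X := exist (fun z => subfun Q z = subfun Q x) x eq_refl
           : fibre (subfun Q) (subfun Q x)).
pose (Y := exist (fun z => subfun Q z = subfun Q y) y eq_refl
           : fibre (subfun Q) (subfun Q y)).
assert (HU : cart_lift (fhom (subfun Q) u) X Y u).
{ split; [exact Hu|]. unfold hom_over, over.
  refine (eq_trans (comp_id_l _) (eq_sym (comp_id_r _))). }
destruct (HL _ _ (fhom (subfun Q) u) Y) as [X' [v Hv]].
destruct (cart_lift_full HQ Hv) as [sv HV].
destruct (cart_lift_iso HU HV) as [s [s' [ss [ss' es]]]].
assert (es' : v ∘ proj1_sig (fhom (fibre_incl _) s) = proj1_sig u)
  by exact (f_equal (@proj1_sig _ _) es).
rewrite <- es'.
apply (f_equal (fhom (fibre_incl _))) in ss, ss'.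
rewrite fhom_comp, fhom_id in ss, ss'.
exact (proj1 (cart_lift_iso_comp ss ss' Hv)).
Qed.

Lemma pullback_hom_incl {a b : subcat (bot Q)} {f : hom a b}
  (I : InverseImage (subfun Q) f) {x y : fibre (subfun Q) b} (m : hom x y) :
  pullback_hom (fhom (fibre_incl b) m) (fhom (fibre_incl a) (fhom I m))
    (proj1_sig (inv_lift I x)) (proj1_sig (inv_lift I y)).
Proof. exact (f_equal (@proj1_sig _ _) (inv_natural I m)). Qed.

Lemma pullback_seq_incl (HQ : forall x y (u : hom x y),
    cartesian (subfun Q) u -> cartesian P (proj1_sig u))
  {a b : subcat (bot Q)} {f : hom a b} (I : InverseImage (subfun Q) f)
  {x y z : fibre (subfun Q) b} (i : hom x y) (p : hom y z) :
  pullback_seq (proj1_sig f) (fhom (fibre_incl b) i) (fhom (fibre_incl b) p)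
    (fhom (fibre_incl a) (fhom I i)) (fhom (fibre_incl a) (fhom I p)).
Proof.
exists (proj1_sig (inv_lift I x)), (proj1_sig (inv_lift I y)),
  (proj1_sig (inv_lift I z)).
split; [|split; [|split; [|split]]].
1-3: apply (cart_lift_incl HQ), inv_cart_lift.
all: apply pullback_hom_incl.
Qed.

Lemma additive_incl (HQ : globally_full Q) (HQ' : forall x y (u : hom x y),
    cartesian (subfun Q) u -> cartesian P (proj1_sig u))
  (X : forall b : B, ExactData (fibre P b))
  {a b : subcat (bot Q)} {f : hom a b}
  (K : InverseImage P (proj1_sig f)) (I : InverseImage (subfun Q) f) :
  additive_functor (X (proj1_sig b)) (X (proj1_sig a)) K ->
  additive_functor (sub_exact X HQ b) (sub_exact X HQ a) I.
Proof.
intros HK x y m n.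
apply (@fibre_incl_faithful _ _ P Q a).
cbn [preadd sub_exact induced_exact add induced_preadditive].
rewrite lift_homK.
(* Both sides are inverse images of the sum of [m] and [n], so they agree after composition with a
   lifting that is Cartesian in [P]. *)
apply (cart_lift_vert_inj _ _ (cart_lift_incl HQ' (inv_cart_lift I y))).
pose proof (pullback_hom_add K HK
  (cart_lift_incl HQ' (inv_cart_lift I x)) (cart_lift_incl HQ' (inv_cart_lift I y))
  (pullback_hom_incl I m) (pullback_hom_incl I n)) as H.
refine (eq_trans _ (eq_sym H)).
refine (eq_trans (pullback_hom_incl I _) _).
refine (f_equal (fun k => k ∘ _) _).
exact (f_equal (@proj1_sig _ _)
  (lift_homK (fibre_incl_full HQ (b := b))
     (add (X (proj1_sig b)) (fhom (fibre_incl b) m) (fhom (fibre_incl b) n)))).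
Qed.
End Subfunctors.

(** * Local triviality by [J_l]-coverings, and inverse images in [Loc] *)

Section LocalTriviality.
Context {E B : Category} {P : Functor E B} {J : CoveringFunction B}
  {Triv : Subfunctor P}.

(** Counterpart of [trivial_inverse_image] for an object of the fibre over [b], whose image under
    [P] need only be propositionally equal to [b]. *)
Definition trivial_along {a b : B} (f : hom a b) (y : fibre P b) : Prop :=
  exists (x : fibre P a) u, cart_lift f x y u /\ sub_ob (top Triv) (proj1_sig x).

Lemma trivial_along_base {a b : B} {f : hom a b} {y : fibre P b} :
  trivial_along f y -> sub_ob (bot Triv) a.
Proof.
intros [[x px] [u [_ tx]]]; subst a; exact (restr_ob tx).
Qed.

Lemma locally_trivial_iff {b : B} (y : fibre P b) :
  locally_trivial J Triv (proj1_sig y) <->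
  exists R : Covering b, J b R /\ forall a (f : hom a b), R a f -> trivial_along f y.
Proof.
destruct y as [y py]; subst b; split; intros [R [JR H]]; exists R;
  split; try exact JR; intros a f r.
- destruct (H a f r) as [x [px [u [Hu [Ou tx]]]]].
  now exists (exist _ x px), u.
- destruct (H a f r) as [[x px] [u [[Hu Ou] tx]]].
  now exists x, px, u.
Qed.

Context (site : fibred_site J Triv).

Lemma trivial_locally_trivial_base {b : B} :
  sub_ob (bot Triv) b -> locally_trivial_base J Triv b.
Proof.
intros tb; exists (@id_covering B b); split; [apply (site_M site)|].
now intros a f [].
Qed.

(** Repleteness of [Triv] makes triviality independent of the chosen Cartesian lifting. *)
Lemma trivial_along_lift {a b : B} {f : hom a b} {x : fibre P a} {y : fibre P b} {u} :
  trivial_along f y -> cart_lift f x y u -> sub_ob (top Triv) (proj1_sig x).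
Proof.
intros [x' [u' [Hu' tx']]] Hu.
destruct (cart_lift_iso Hu' Hu) as [s [s' [ss [ss' _]]]].
refine (proj2 (proj2 (site_Triv site)) a x' x _ tx').
now exists s, s'.
Qed.

(** By fullness [g] is a morphism of trivial objects, so the trivial inverse image along [f] has a
    lifting over [g] inside [Triv]. It is Cartesian in [P], since [Triv] is a subfibration. *)
Lemma trivial_along_comp {a b c : B} {f : hom b c} {g : hom a b} {y : fibre P c} :
  trivial_along f y -> sub_ob (bot Triv) a -> trivial_along (f ∘ g) y.
Proof.
intros Hf ta; pose proof (trivial_along_base Hf) as tb.
destruct Hf as [x [u [Hu tx]]].
destruct (site_Triv site) as [[HF HC] [[_ HG] _]].
pose (a' := exist _ a ta : subcat (bot Triv)).
pose (b' := exist _ b tb : subcat (bot Triv)).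
pose (g' := exist _ g (HG _ _ g ta tb) : hom a' b').
destruct (@fibre_incl_ob _ _ _ Triv b' x tx) as [x' e]; subst x.
destruct (fibration_lift HF g' x') as [z [v Hv]].
exists (fibre_incl a' z), (u ∘ proj1_sig v).
split; [exact (cart_lift_comp Hu (cart_lift_incl HC Hv))|].
exact (proj2_sig (proj1_sig z)).
Qed.

Notation LocB := (subcat (bot (Loc J Triv))).

(** By (M) trivial objects are locally trivial, so a covering with trivial domains consists of
    arrows of [Loc] and coincides with its [image_covering]. *)
Lemma J_l_covering {c : LocB} (R : Covering (proj1_sig c)) :
  J (proj1_sig c) R ->
  (forall a (f : hom a (proj1_sig c)), R a f -> sub_ob (bot Triv) a) ->
  J_l J Triv (c := c) (fun a f => R (proj1_sig a) (proj1_sig f)).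
Proof.
intros JR HR; split; [|intros a f r; exact (HR _ _ r)].
replace (image_covering _) with R; [exact JR|].
apply functional_extensionality_dep; intros a.
apply functional_extensionality; intros f.
apply propositional_extensionality; split.
- intros r.
  pose proof (trivial_locally_trivial_base (HR a f r)) as la.
  now exists la, (conj la (proj2_sig c)).
- intros [sa [sf r]]; exact r.
Qed.

(** A trivial inverse image lies over a trivial object, so a trivializing [J]-covering automatically
    has trivial domains. *)
Lemma locally_trivial_J_l {c : LocB} (y : fibre P (proj1_sig c)) :
  locally_trivial J Triv (proj1_sig y) <->
  exists R : Covering c, J_l J Triv R /\
    forall a (f : hom a c), R a f -> trivial_along (proj1_sig f) y.
Proof.
rewrite locally_trivial_iff; split; intros [R [JR H]].
- eexists; split.
  + apply (J_l_covering R JR).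
    intros a f r; exact (trivial_along_base (H a f r)).
  + intros a f r; exact (H _ _ r).
- exists (image_covering R); split; [exact (proj1 JR)|].
  intros a f [sa [sf r]]; exact (H _ _ r).
Qed.

(** The domain of a Cartesian lifting in [P] is itself locally trivial: (C) pulls a trivializing
    covering of [y] back along [f], and this trivializes the lifting. *)
Lemma Loc_lift {a b : LocB} (f : hom a b) (y : fibre (subfun (Loc J Triv)) b) :
  exists (x : fibre (subfun (Loc J Triv)) a) u,
    cart_lift (proj1_sig f) (fibre_incl a x) (fibre_incl b y) u.
Proof.
destruct (fibration_lift (site_fibration site) (proj1_sig f) (fibre_incl b y))
  as [x [u Hu]].
assert (lx : locally_trivial J Triv (proj1_sig x)).
{ destruct (proj1 (locally_trivial_J_l (fibre_incl b y)) (proj2_sig (proj1_sig y)))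
    as [R [JR HR]].
  destruct (site_C site JR f) as [S [JS HS]].
  apply locally_trivial_J_l; exists S; split; [exact JS|].
  intros c g Sg.
  destruct (HS _ (f ∘ g)) as [d [t [h [Rt e]]]]; [now exists g|].
  destruct (fibration_lift (site_fibration site) (proj1_sig g) x) as [z [v Hv]].
  exists z, v; split; [exact Hv|].
  (* The composite [u ∘ v] is a Cartesian lifting over [f ∘ g], so only triviality of [y] along
     [f ∘ g] remains; this arrow factors through the trivializing [t]. *)
  refine (trivial_along_lift _ (cart_lift_comp Hu Hv)).
  assert (e' : proj1_sig f ∘ proj1_sig g = proj1_sig t ∘ proj1_sig h)
    by exact (f_equal (@proj1_sig _ _) e).
  rewrite e'.
  exact (trivial_along_comp (HR _ _ Rt) (proj2 JS _ _ Sg)). }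
destruct (@fibre_incl_ob _ _ _ (Loc J Triv) a x lx) as [x' e]; subst x.
now exists x', u.
Qed.

Lemma Loc_cartesian :
  forall x y (u : hom x y),
    cartesian (subfun (Loc J Triv)) u -> cartesian P (proj1_sig u).
Proof. exact (cartesian_incl (Loc_globally_full J Triv) (@Loc_lift)). Qed.

Lemma Loc_inverse_image {a b : LocB} (f : hom a b) :
  inhabited (InverseImage (subfun (Loc J Triv)) f).
Proof.
apply inverse_image_inhabited; intros y.
destruct (Loc_lift f y) as [x [u Hu]].
destruct (cart_lift_full (Loc_globally_full J Triv) Hu) as [su HU].
now exists x, (exist _ u su).
Qed.

(** For each [f] in [R], (C) pulls [S] back along [f], and (L) refines the resulting composite
    covering. Its arrows factor through [R] by construction and through [S] by the choice of the
    pullbacks. *)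
Lemma common_refinement (HL : axiom_L (J_l J Triv)) {c : LocB} {R S : Covering c} :
  J_l J Triv R -> J_l J Triv S ->
  exists T, J_l J Triv T /\ refines T R /\ refines T S.
Proof.
intros JR JS.
(* A covering is chosen for every arrow into [c], in [R] or not, as (C) applies to all of them. *)
destruct (choice_dependent
  (fun (q : {a : LocB & hom a c}) (U : Covering (projT1 q)) =>
     J_l J Triv U /\ refines (post_covering (projT2 q) U) S)) as [U HU].
{ intros [a f]; exact (site_C site JS f). }
destruct (HL c R JR (fun a f _ => U (existT _ a f))) as [T [JT HT]].
{ intros a f _; apply (HU (existT _ a f)). }
exists T; split; [exact JT|split]; intros a t Tt;
  destruct (HT a t Tt) as [d [k [h [[b [f [Rf [g [Ug ek]]]]] et]]]].
- exists b, f, (g ∘ h); split; [exact Rf|].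
  now rewrite et, ek, comp_assoc.
- destruct (proj2 (HU (existT _ b f)) d k) as [e [k' [h' [Sk' ek']]]].
  { now exists g. }
  exists e, k', (h' ∘ h); split; [exact Sk'|].
  now rewrite et, ek', comp_assoc.
Qed.

Lemma trivial_along_refines {c : LocB} {R T : Covering c} {y : fibre P (proj1_sig c)} :
  J_l J Triv T -> refines T R ->
  (forall a (f : hom a c), R a f -> trivial_along (proj1_sig f) y) ->
  forall a (f : hom a c), T a f -> trivial_along (proj1_sig f) y.
Proof.
intros JT HT HR a f Tf; destruct (HT a f Tf) as [b [g [h [Rg e]]]].
rewrite e; exact (trivial_along_comp (HR _ _ Rg) (proj2 JT _ _ Tf)).
Qed.

Lemma common_trivializing_covering (HL : axiom_L (J_l J Triv)) {c : LocB}
  {x y z : fibre P (proj1_sig c)} :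
  locally_trivial J Triv (proj1_sig x) ->
  locally_trivial J Triv (proj1_sig y) ->
  locally_trivial J Triv (proj1_sig z) ->
  exists T : Covering c, J_l J Triv T /\ forall a (f : hom a c), T a f ->
    trivial_along (proj1_sig f) x /\ trivial_along (proj1_sig f) y /\
    trivial_along (proj1_sig f) z.
Proof.
rewrite !locally_trivial_J_l.
intros [R [JR HR]] [S [JS HS]] [U [JU HU]].
destruct (common_refinement HL JR JS) as [V [JV [VR VS]]].
destruct (common_refinement HL JV JU) as [T [JT [TV TU]]].
exists T; split; [exact JT|].
intros a f Tf; split; [|split].
- exact (trivial_along_refines JT TV (trivial_along_refines JV VR HR) a f Tf).
- exact (trivial_along_refines JT TV (trivial_along_refines JV VS HS) a f Tf).
- exact (trivial_along_refines JT TU HU a f Tf).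
Qed.
End LocalTriviality.

(** * Exactness of inverse images of trivial sequences *)

Section FlatTrivial.
Context {E B : Category} {P : Functor E B} {J : CoveringFunction B}
  {Triv : Subfunctor P} {A : forall b : B, Preadditive (fibre P b)}
  (site : abelian_fibred_site J Triv A)
  (triv_flat : forall (a b : subcat (bot Triv)) (f : hom a b),
     flat (exact_Triv site) f).

(** By fullness the sequence and the arrow [f] belong to [Triv], where [f] is flat. Admissibility in
    [Triv] is by definition short exactness in the fibre of [P], so the result returns to [P]. *)
Lemma trivial_pullback_short_exact {a b : B} (ta : sub_ob (bot Triv) a)
  (f : hom a b) {x y z : fibre P b} {i : hom x y} {p : hom y z} :
  sub_ob (top Triv) (proj1_sig x) -> sub_ob (top Triv) (proj1_sig y) ->
  sub_ob (top Triv) (proj1_sig z) -> short_exact (A b) i p ->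
  exists (x' y' z' : fibre P a) (i' : hom x' y') (p' : hom y' z'),
    pullback_seq f i p i' p' /\ short_exact (A a) i' p'.
Proof.
intros tx ty tz Hip.
(* The base [b] is trivial because the trivial object [x] lies over it. *)
assert (tb : sub_ob (bot Triv) b).
{ destruct x as [x px]; subst b; exact (restr_ob tx). }
destruct (site_Triv (absite_site site)) as [[_ HC] [HG _]].
pose (a' := exist _ a ta : subcat (bot Triv)).
pose (b' := exist _ b tb : subcat (bot Triv)).
pose (f' := exist _ f (proj2 HG _ _ f ta tb) : hom a' b').
destruct (@fibre_incl_ob _ _ _ Triv b' x tx) as [x' ex]; subst x.
destruct (@fibre_incl_ob _ _ _ Triv b' y ty) as [y' ey]; subst y.
destruct (@fibre_incl_ob _ _ _ Triv b' z tz) as [z' ez]; subst z.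
destruct (fibre_incl_full HG i) as [i' ei]; subst i.
destruct (fibre_incl_full HG p) as [p' ep]; subst p.
destruct (triv_flat a' b' f') as [[I] HI].
do 5 eexists; split.
- exact (pullback_seq_incl HC I i' p').
- exact (proj2 (HI I) _ _ _ i' p' Hip).
Qed.
End FlatTrivial.

(** * Flatness of morphisms of locally trivial objects *)

Theorem proposition4p17 (E B : Category) (P : Functor E B)
  (J : CoveringFunction B) (Triv : Subfunctor P)
  (A : forall b : B, Preadditive (fibre P b))
  (site : abelian_fibred_site J Triv A)
  (loc_ff : forall (c : subcat (bot (Loc J Triv))) (R : Covering c),
     J_l J Triv R -> faithfully_flat (exact_Loc (Triv := Triv) A) R)
  (triv_flat : forall (a b : subcat (bot Triv)) (f : hom a b),
     flat (exact_Triv site) f) :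
  forall (a b : subcat (bot (Loc J Triv))) (f : hom a b),
    flat (exact_Loc A) f.
Proof.
intros a b f.
pose proof (absite_site site) as fsite.
pose proof (Loc_cartesian fsite) as HC.
destruct (absite_abelian site) as [HP [_ Hadd]].
split; [exact (Loc_inverse_image fsite f)|].
intros I; split.
(* Additivity of [I] is inherited from any inverse image functor [K] of [P] along the same arrow. *)
{ destruct (inverse_image_inhabited (proj1_sig f)
    (fibration_lift HP (proj1_sig f))) as [K].
  exact (additive_incl (Loc_globally_full J Triv) HC (exact_P A) K I (Hadd _ _ _ K)). }
intros x y z i p Hip.
destruct (common_trivializing_covering fsite (absite_L site)
  (x := fibre_incl b x) (y := fibre_incl b y) (z := fibre_incl b z)
  (proj2_sig (proj1_sig x)) (proj2_sig (proj1_sig y)) (proj2_sig (proj1_sig z)))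
  as [T [JT HT]].
destruct (site_C fsite JT f) as [S [JS HS]].
(* The predicate is [True]: only some inverse image functor of [Loc] along each arrow into [a] is
   wanted. *)
destruct (choice_dependent
  (fun (q : {c : subcat (bot (Loc J Triv)) & hom c a})
     (_ : InverseImage (subfun (Loc J Triv)) (projT2 q)) => True)) as [K _].
{ intros [c g]; destruct (Loc_inverse_image fsite g) as [K]; now exists K. }
(* Here [S] reflects exactness: it suffices to test the sequence after inverse image along each [g]
   in [S]. *)
apply (proj2 (loc_ff a S JS) (fun c g _ => K (existT _ c g))).
intros c g Sg.
destruct (HS _ (f ∘ g)) as [d [t [h [Tt e]]]]; [now exists g|].
assert (e' : proj1_sig f ∘ proj1_sig g = proj1_sig t ∘ proj1_sig h)
  by exact (f_equal (@proj1_sig _ _) e).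
(* The iterated inverse image along [f] and then [g] is one along [f ∘ g], hence along [t ∘ h]. *)
pose proof (pullback_seq_comp (pullback_seq_incl HC I i p)
  (pullback_seq_incl HC (K (existT _ c g)) _ _)) as Hfg.
cbn [projT1 projT2] in Hfg; rewrite e' in Hfg.
destruct (absite_flat site JT Tt) as [[L] HL].
pose proof (pullback_seq_inv L (fhom (fibre_incl b) i) (fhom (fibre_incl b) p)) as Ht.
pose proof (proj2 (HL L) _ _ _ _ _ Hip) as Et.
destruct (HT d t Tt) as [tx [ty tz]].
(* The inverse image along [t] is short exact by flatness in [P] and has trivial objects by the
   choice of [T]. The domain [c] of [h] is trivial because [g] belongs to [S]. *)
destruct (trivial_pullback_short_exact site triv_flat (proj2 JS c g Sg) (proj1_sig h)
  (trivial_along_lift fsite tx (inv_cart_lift L _))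
  (trivial_along_lift fsite ty (inv_cart_lift L _))
  (trivial_along_lift fsite tz (inv_cart_lift L _)) Et)
  as [x' [y' [z' [i' [p' [Hh Eh]]]]]].
(* Two inverse images of the same sequence along [t ∘ h] are compared, one of them known to be short
   exact. *)
exact (short_exact_pullback_seq (A (proj1_sig c))
  (pullback_seq_comp Ht Hh) Hfg Eh).
Qed.
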